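(* Let $G$ be a graph and let $d\ge 2$ be an integer. Given a tree decomposition $\mathcal{T}$ and a layering $(V_1,V_2,\ldots)$ of $G$ witnessing layered treewidth $k$, it is possible to compute, in time $\mathcal{O}(|\mathcal{T}|\cdot(|V(G)|+|E(G)|))$, a tree decomposition $\mathcal{T}^d$ with $|\mathcal{T}^d|=|\mathcal{T}|$ and a layering of the graph $G^d$ witnessing layered tree-independence number $2dk$ if $d$ is even, and $(2d-1)k$ if $d$ is odd.
   Context: All graphs are finite and simple; $\alpha$ denotes the independence number. The $d$-th power $G^d$ has vertex set $V(G)$, with distinct $u,v$ adjacent iff they are at distance at most $d$ in $G$. A tree decomposition of $G$ is a pair $\mathcal{T}=(T,\{X_t\}_{t\in V(T)})$ with $T$ a tree and bags $X_t\subseteq V(G)$ such that every vertex is in some bag, both endpoints of every edge lie in a common bag, and for each $u\in V(G)$ the nodes $t$ with $u\in X_t$ induce a connected subgraph of $T$; $|\mathcal{T}|=|V(T)|$. A layering of $G$ is an ordered partition $(V_1,V_2,\ldots)$ of $V(G)$ (parts may be empty, all but finitely many are) such that for each edge $uv$ with $u\in V_i$, $v\in V_j$ we have $|i-j|\le 1$. A tree decomposition $(T,\{X_t\})$ and a layering $(V_1,V_2,\ldots)$ of a graph witness layered treewidth (resp. layered tree-independence number) $\ell$ if $|X_t\cap V_i|\le\ell$ (resp. the subgraph induced by $X_t\cap V_i$ has independence number at most $\ell$) for every bag $X_t$ and layer $V_i$. *)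

(* Defs.v *)
From HB Require Import structures.
From mathcomp Require Import all_boot.
Set Implicit Arguments.
Unset Strict Implicit.
Unset Printing Implicit Defensive.

(** * Graphs *)

Record sgraph := SGraph {
  vertex :> finType;
  edge : rel vertex;
  edge_sym : symmetric edge;
  edge_irr : irreflexive edge }.
Arguments edge {s}.

Definition edges (G : sgraph) : {set {set G}} :=
  [set e | [exists x : G, exists y : G, edge x y && (e == [set x; y])]].

Definition neighbours (G : sgraph) (x : G) : {set G} := [set y | edge x y].

Definition stable (G : sgraph) (S : {set G}) : bool :=
  [forall x in S, forall y in S, ~~ edge x y].

Definition alpha (G : sgraph) : nat := \max_(S : {set G} | stable S) #|S|.

Section Induced.
Variables (G : sgraph) (S : {set G}).

Definition induced_edge : rel {x : G | x \in S} :=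
  fun x y => edge (val x) (val y).

Lemma induced_edge_sym : symmetric induced_edge.
Proof. by move=> x y; apply: edge_sym. Qed.

Lemma induced_edge_irr : irreflexive induced_edge.
Proof. by move=> x; apply: edge_irr. Qed.

Definition induced : sgraph := SGraph induced_edge_sym induced_edge_irr.
End Induced.

(* The distance from x to y is at most d: some walk of length at most d joins
   them; in particular this fails when they lie in different components. *)
Definition dist_le (G : sgraph) (d : nat) (x y : G) : bool :=
  [exists l : 'I_d.+1, exists p : l.-tuple G, path edge x p && (last x p == y)].

Lemma dist_leP (G : sgraph) (d : nat) (x y : G) :
  reflect (exists p : seq G, [/\ size p <= d, path edge x p & last x p = y])
          (dist_le d x y).
Proof.
apply: (iffP existsP) => [[l /existsP[p /andP[xp /eqP lp]]] | [p [sp xp lp]]].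
  by exists p; split; rewrite // size_tuple -ltnS.
exists (Ordinal (sp : size p < d.+1)); apply/existsP.
by exists (in_tuple p); rewrite /= xp lp eqxx.
Qed.

Lemma dist_le_sym (G : sgraph) (d : nat) : symmetric (@dist_le G d).
Proof.
have W (x y : G) : dist_le d x y -> dist_le d y x.
  move=> /dist_leP[p [sp xp lp]]; apply/dist_leP.
  exists (rev (belast x p)); split.
  - by rewrite size_rev size_belast.
  - rewrite -lp rev_path (eq_path (e' := edge)) // => u v.
    by rewrite edge_sym.
  - by case: p {sp xp} lp => [|z p] //= _; rewrite rev_cons last_rcons.
by move=> x y; apply/idP/idP; apply: W.
Qed.

Section Power.
Variables (G : sgraph) (d : nat).

Definition power_edge : rel G := fun x y => (x != y) && dist_le d x y.

Lemma power_edge_sym : symmetric power_edge.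
Proof. by move=> x y; rewrite /power_edge eq_sym dist_le_sym. Qed.

Lemma power_edge_irr : irreflexive power_edge.
Proof. by move=> x; rewrite /power_edge eqxx. Qed.

Definition power : sgraph := SGraph power_edge_sym power_edge_irr.
End Power.

(** * Tree decompositions and layerings *)

Definition is_tree (T : sgraph) : Prop :=
  [/\ 0 < #|T|,
      forall x y : T, connect edge x y
    & forall c : seq T, 2 < size c -> ~ ucycle edge c].

Definition tree_decomposition (G T : sgraph) (X : T -> {set G}) : Prop :=
  [/\ is_tree T,
      forall u : G, exists t, u \in X t,
      forall u v : G, edge u v -> exists t, (u \in X t) && (v \in X t)
    & forall (u : G) (s t : T), u \in X s -> u \in X t ->
        connect (fun a b => [&& edge a b, u \in X a & u \in X b]) s t].

(* A layering is given by the index of the layer of each vertex; layers are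
   indexed from 0, so V_(i+1) is [layer lay i]. *)
Definition layer (G : sgraph) (lay : G -> nat) (i : nat) : {set G} :=
  [set v | lay v == i].

Definition layering (G : sgraph) (lay : G -> nat) : Prop :=
  forall u v : G, edge u v -> lay u <= (lay v).+1 /\ lay v <= (lay u).+1.

Definition witness_ltw (G T : sgraph) (X : T -> {set G}) (lay : G -> nat)
    (l : nat) : Prop :=
  [/\ tree_decomposition X, layering lay
    & forall (t : T) (i : nat), #|X t :&: layer lay i| <= l].

Definition witness_ltin (G T : sgraph) (X : T -> {set G}) (lay : G -> nat)
    (l : nat) : Prop :=
  [/\ tree_decomposition X, layering lay
    & forall (t : T) (i : nat), alpha (induced (X t :&: layer lay i)) <= l].

Arguments witness_ltw : clear implicits.
Arguments witness_ltin : clear implicits.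

(** * The model of computation: a word RAM

    Programs are structured programs over registers and a random access
    memory, both indexed by natural numbers.  The parameter [W] bounds the
    machine words: evaluation is stuck as soon as some value, intermediate
    results and addresses included, is not below [W]. *)

Inductive binop := Add | Sub | Mul | Div | Mod | Eqn | Leqn.

Inductive expr :=
  | Cst of nat
  | Reg of nat
  | Mem of expr
  | Bin of binop & expr & expr.

Inductive cmd :=
  | Skip
  | Set_ of nat & expr          (* register := value *)
  | Store of expr & expr        (* memory[address] := value *)
  | Seq of cmd & cmd
  | If of expr & cmd & cmd
  | While of expr & cmd.

Record state := State { reg : nat -> nat; mem : nat -> nat }.

Definition upd (f : nat -> nat) (x v : nat) : nat -> nat :=
  fun y => if y == x then v else f y.

Definition set_reg (s : state) (x v : nat) := State (upd (reg s) x v) (mem s).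
Definition set_mem (s : state) (a v : nat) := State (reg s) (upd (mem s) a v).

Definition binop_sem (o : binop) (a b : nat) : nat :=
  match o with
  | Add => a + b
  | Sub => a - b
  | Mul => a * b
  | Div => a %/ b
  | Mod => a %% b
  | Eqn => a == b
  | Leqn => a <= b
  end.

Section Semantics.
Variable W : nat.

Definition word (v : nat) : option nat := if v < W then Some v else None.

Fixpoint eval (s : state) (e : expr) : option nat :=
  match e with
  | Cst n => word n
  | Reg x => word (reg s x)
  | Mem a => if eval s a is Some i then word (mem s i) else None
  | Bin o a b =>
      if eval s a is Some m then
        if eval s b is Some n then word (binop_sem o m n) else None
      else None
  end.

(* [exec c s t s']: started in s, the program c halts in s' after time t.
   Each assignment, store and test costs 1: the expressions of a fixed program
   have bounded size, so this is the unit-cost measure up to a constant. *)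
Inductive exec : cmd -> state -> nat -> state -> Prop :=
  | ExecSkip s : exec Skip s 1 s
  | ExecSet s x e v :
      eval s e = Some v -> exec (Set_ x e) s 1 (set_reg s x v)
  | ExecStore s a e i v :
      eval s a = Some i -> eval s e = Some v ->
      exec (Store a e) s 1 (set_mem s i v)
  | ExecSeq c1 c2 s1 s2 s3 t1 t2 :
      exec c1 s1 t1 s2 -> exec c2 s2 t2 s3 ->
      exec (Seq c1 c2) s1 (t1 + t2) s3
  | ExecIf e c1 c2 s s' v t :
      eval s e = Some v -> exec (if v != 0 then c1 else c2) s t s' ->
      exec (If e c1 c2) s t.+1 s'
  | ExecWhileStop e c s :
      eval s e = Some 0 -> exec (While e c) s 1 s
  | ExecWhileStep e c s1 s2 s3 v t1 t2 :
      eval s1 e = Some v -> v != 0 ->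
      exec c s1 t1 s2 -> exec (While e c) s2 t2 s3 ->
      exec (While e c) s1 (t1 + t2).+1 s3.
End Semantics.

(* The input is stored from address 0 on, everything else is initially 0. *)
Definition init (inp : seq nat) : state :=
  State (fun=> 0) (fun i => nth 0 inp i).

(* The output starts at the address found in register 0. *)
Definition has_output (s : state) (out : seq nat) : Prop :=
  forall i, i < size out -> mem s (reg s 0 + i) = nth 0 out i.

Definition magnitude (inp : seq nat) : nat :=
  2 + size inp + \max_(v <- inp) v.

(* [p] computes [out] from [inp] in time at most [time] on words of
   [b * log2 (magnitude inp)] bits. *)
Definition computes (p : cmd) (b : nat) (inp out : seq nat) (time : nat) :
    Prop :=
  exists t s, [/\ exec (magnitude inp ^ b) p (init inp) t s,
                  has_output s out & t <= time].

(** * Encodings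

    Elements of a finite type are numbered by [enum_rank].  A sequence of lists
    is stored as its length m, followed by m + 1 offsets (the i-th and the
    (i+1)-st delimit the i-th list) and by the concatenation of the lists. *)

Definition encode_lists (ls : seq (seq nat)) : seq nat :=
  size ls :: (0 :: scanl addn 0 (shape ls)) ++ flatten ls.

(* [w] encodes the family of sets [X], each set being listed in any order and
   without repetition. *)
Definition encodes_family (A B : finType) (X : A -> {set B}) (w : seq nat) :
    Prop :=
  exists ls : seq (seq nat),
    [/\ w = encode_lists ls, size ls = #|A|
      & forall a : A,
          perm_eq (nth [::] ls (enum_rank a))
                  [seq nat_of_ord (enum_rank b) | b in X a]].

(* Adjacency lists. *)
Definition encodes_graph (G : sgraph) (w : seq nat) : Prop :=
  encodes_family (@neighbours G) w.

Definition encode_layering (G : sgraph) (lay : G -> nat) : seq nat :=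
  [seq lay v | v <- enum G].

Definition encodes_input (d : nat) (G T : sgraph) (X : T -> {set G})
    (lay : G -> nat) (w : seq nat) : Prop :=
  exists wG wT wX : seq nat,
    [/\ encodes_graph G wG, encodes_graph T wT, encodes_family X wX
      & w = d :: wG ++ wT ++ wX ++ encode_layering lay].

Definition encodes_output (G T : sgraph) (X : T -> {set G}) (lay : G -> nat)
    (w : seq nat) : Prop :=
  exists wT wX : seq nat,
    [/\ encodes_graph T wT, encodes_family X wX
      & w = wT ++ wX ++ encode_layering lay].

Arguments encodes_input : clear implicits.
Arguments encodes_output : clear implicits.

(* Main.v *)
Require Import Defs.
From mathcomp Require Import all_boot.
From mathcomp Require Import zify.
Set Implicit Arguments.
Unset Strict Implicit.
Unset Printing Implicit Defensive.

(** Keep the tree, replace each bag by the ball of radius r = floor(d/2) around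
    it, and merge the layers by blocks of d consecutive ones.  Two vertices at
    distance at most d have a middle vertex or a middle edge within r of both, so
    a common new bag; the nodes whose new bag contains u form the union of the
    subtrees of the vertices of the connected set N^r[u].  Map each vertex of an
    independent set of G^d inside a new bag and a new layer to a vertex of the
    old bag within r of it: this is injective, as 2r <= d, and the image lies in
    d + 2r consecutive old layers, whence the bound (d + 2r)k.  Each ball is
    found by one breadth-first search stopped after r rounds; its marks are
    stamps depending on the node, so they never have to be cleared. *)

(** * Breadth-first search *)

(* The names below are shadowed by all_boot. *)
Local Notation Fetch := Defs.Mem.
Local Notation Minus := Defs.Sub.
Local Notation memory := Defs.mem.

Section Search.
Variables (T : eqType) (adj : T -> seq T).

Definition push (Q : seq T) w := if w \in Q then Q else rcons Q w.
Definition scan := foldl push.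
Definition expand (Q F : seq T) := foldl (fun Q v => scan Q (adj v)) Q F.

(** The queue [Q] doubles as the set of visited vertices, and its entries from position [lo] on are
    the frontier. The test [lo < size Q] stops the search once a round finds nothing new, so that
    the number of rounds is bounded by the number of vertices found, however large [r] is. *)
Fixpoint bfs (r lo : nat) (Q : seq T) : seq T :=
  if r is r'.+1 then
    if lo < size Q then bfs r' (size Q) (expand Q (drop lo Q)) else Q
  else Q.

Lemma mem_push Q w v : (v \in push Q w) = (v \in Q) || (v == w).
Proof.
rewrite /push; case: ifP => [wQ|_]; last by rewrite mem_rcons inE orbC.
by case: eqP => [->|]; rewrite ?wQ ?orbF.
Qed.

Lemma push_uniq Q w : uniq Q -> uniq (push Q w).
Proof. by rewrite /push; case: ifP => // wQ; rewrite rcons_uniq wQ. Qed.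

Lemma push_prefix Q w : exists R, push Q w = Q ++ R.
Proof.
rewrite /push; case: ifP => _; first by exists [::]; rewrite cats0.
by exists [:: w]; rewrite cats1.
Qed.

Lemma mem_scan Q s v : (v \in scan Q s) = (v \in Q) || (v \in s).
Proof.
elim: s Q => [|w s IH] Q /=; first by rewrite orbF.
by rewrite IH mem_push inE orbA.
Qed.

Lemma scan_uniq Q s : uniq Q -> uniq (scan Q s).
Proof. by elim: s Q => [|w s IH] Q //= uQ; apply/IH/push_uniq. Qed.

Lemma scan_prefix Q s : exists R, scan Q s = Q ++ R.
Proof.
elim: s Q => [|w s IH] Q /=; first by exists [::]; rewrite cats0.
have [R1 ->] := IH (push Q w); have [R2 ->] := push_prefix Q w.
by exists (R2 ++ R1); rewrite catA.
Qed.

Lemma mem_expand Q F v :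
  (v \in expand Q F) = (v \in Q) || has (fun u => v \in adj u) F.
Proof.
elim: F Q => [|u F IH] Q /=; first by rewrite orbF.
by rewrite IH mem_scan orbA.
Qed.

Lemma expand_uniq Q F : uniq Q -> uniq (expand Q F).
Proof. by elim: F Q => [|u F IH] Q //= uQ; apply/IH/scan_uniq. Qed.

Lemma expand_prefix Q F : exists R, expand Q F = Q ++ R.
Proof.
elim: F Q => [|u F IH] Q /=; first by exists [::]; rewrite cats0.
have [R1 ->] := IH (scan Q (adj u)); have [R2 ->] := scan_prefix Q (adj u).
by exists (R2 ++ R1); rewrite catA.
Qed.

Lemma bfs_uniq r lo Q : uniq Q -> uniq (bfs r lo Q).
Proof.
elim: r lo Q => [|r IH] lo Q //= uQ.
by case: ifP => // _; apply/IH/expand_uniq.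
Qed.

Lemma bfs_prefix r lo Q : exists R, bfs r lo Q = Q ++ R.
Proof.
elim: r lo Q => [|r IH] lo Q /=; first by exists [::]; rewrite cats0.
case: ifP => _; last by exists [::]; rewrite cats0.
have [R1 ->] := IH (size Q) (expand Q (drop lo Q)).
have [R2 ->] := expand_prefix Q (drop lo Q).
by exists (R2 ++ R1); rewrite catA.
Qed.

Lemma all_bfs (P : pred T) r lo Q :
  (forall u, P u -> all P (adj u)) -> all P Q -> all P (bfs r lo Q).
Proof.
move=> Padj; elim: r lo Q => [|r IH] lo Q //= PQ; case: ifP => // _; apply: IH.
apply/allP => v; rewrite mem_expand => /orP[/(allP PQ)//|/hasP[u /mem_drop uQ]].
by move=> vu; apply: (allP (Padj u (allP PQ u uQ))).
Qed.

Definition reach (r : nat) (X : seq T) (v : T) : Prop :=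
  exists x p, [/\ x \in X, size p <= r, path (fun a b => b \in adj a) x p
                & last x p = v].

(** The hypothesis is the invariant of the search: vertices before the frontier have all their
    neighbours in [Q]. Reachability is measured from the current queue, so a round trades one step
    of the walk for one unit of [r]. *)
Lemma mem_bfs r lo Q v :
    (forall u w, u \in take lo Q -> w \in adj u -> w \in Q) ->
  v \in bfs r lo Q <-> reach r Q v.
Proof.
elim: r lo Q => [|r IH] lo Q clQ /=.
  split=> [vQ|[x [p [xQ]]]]; first by exists v, [::].
  by rewrite leqn0 size_eq0 => /eqP-> _ <-.
case: ltnP => [_|leQ].
  set Q' := expand Q _.
  have adjQ u w : u \in Q -> w \in adj u -> w \in Q'.
    move=> uQ wu; rewrite mem_expand; rewrite -(cat_take_drop lo Q) mem_cat in uQ.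
    case/orP: uQ => [uQ|uQ]; first by rewrite (clQ u).
    by apply/orP; right; apply/hasP; exists u.
  have QQ' u : u \in Q -> u \in Q' by rewrite mem_expand => ->.
  have takeQ' : take (size Q) Q' = Q.
    by rewrite /Q'; have [R ->] := expand_prefix Q (drop lo Q); rewrite take_size_cat.
  rewrite IH ?takeQ' //; split=> [[x [p [xQ' szp xp lp]]]|[x [p [xQ szp xp lp]]]].
    move: xQ'; rewrite mem_expand => /orP[xQ|/hasP[u /mem_drop uQ xu]].
      by exists x, p; split=> //; apply: leqW.
    by exists u, (x :: p); rewrite /= xu.
  case: p szp xp lp => [|y p] /= szp xp lp.
    by exists x, [::]; split=> //; apply: QQ'.
  by case/andP: xp => xy yp; exists y, p; split=> //; apply: adjQ xQ xy.
(* The frontier is empty here, so the invariant says that [Q] is closed under adjacency and no walk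
   leaves it. *)
rewrite take_oversize // in clQ.
split=> [vQ|[x [p [xQ _ xp <-]]]]; first by exists v, [::].
elim: p x xQ xp => [|y p IHp] x xQ //= /andP[xy yp].
by apply: IHp => //; apply: clQ xQ xy.
Qed.
End Search.

(** * Timed runs of programs *)

Section Runs.
Variable W : nat.

(* Value of an expression when no intermediate result overflows. *)
Fixpoint den (s : state) (e : expr) : nat :=
  match e with
  | Cst n => n
  | Reg x => reg s x
  | Fetch a => memory s (den s a)
  | Bin o a b => binop_sem o (den s a) (den s b)
  end.

Fixpoint fits (s : state) (e : expr) : Prop :=
  match e with
  | Cst _ | Reg _ => den s e < W
  | Fetch a => fits s a /\ den s e < W
  | Bin _ a b => fits s a /\ fits s b /\ den s e < W
  end.

Lemma eval_fits s e : fits s e -> eval W s e = Some (den s e).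
Proof.
have word_lt v : v < W -> word W v = Some v by rewrite /word => ->.
elim: e => [k|x|a IHa|o a IHa b IHb] /=; try exact: word_lt.
  by case=> /IHa-> /word_lt.
by case=> /IHa-> [/IHb-> /word_lt].
Qed.

(** Total correctness with a time budget: [t] is only an upper bound, and the postcondition may
    itself be a [run], which lets the rules below chain commands. *)
Definition run (c : cmd) (s : state) (t : nat) (Q : state -> Prop) : Prop :=
  exists t' s', [/\ exec W c s t' s', t' <= t & Q s'].

Lemma run_weaken c s t t' (Q Q' : state -> Prop) :
  run c s t Q -> t <= t' -> (forall s', Q s' -> Q' s') -> run c s t' Q'.
Proof.
move=> [u [s' [ex ut Qs]]] tt QQ.
by exists u, s'; split; [|apply: leq_trans tt|apply: QQ].
Qed.

(** Any positive budget is accepted, so that the two branches of a test can share one bound. *)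
Lemma run_skip s t (Q : state -> Prop) : Q s -> run Skip s t.+1 Q.
Proof. by move=> Qs; exists 1, s; split=> //; apply: ExecSkip. Qed.

Lemma run_set s x e (Q : state -> Prop) :
  fits s e -> Q (set_reg s x (den s e)) -> run (Set_ x e) s 1 Q.
Proof.
move=> /eval_fits ev Qs; exists 1, (set_reg s x (den s e)).
by split=> //; apply: ExecSet.
Qed.

Lemma run_store s a e (Q : state -> Prop) :
    fits s a -> fits s e -> Q (set_mem s (den s a) (den s e)) ->
  run (Store a e) s 1 Q.
Proof.
move=> /eval_fits eva /eval_fits ev Qs; exists 1, (set_mem s (den s a) (den s e)).
by split=> //; apply: ExecStore.
Qed.

Lemma run_seq c1 c2 s t1 t2 (Q : state -> Prop) :
  run c1 s t1 (fun s1 => run c2 s1 t2 Q) -> run (Seq c1 c2) s (t1 + t2) Q.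
Proof.
move=> [u1 [s1 [ex1 le1 [u2 [s2 [ex2 le2 Qs]]]]]].
exists (u1 + u2), s2; split=> //; first exact: ExecSeq ex1 ex2.
exact: leq_add.
Qed.

Lemma run_if e c1 c2 s t (Q : state -> Prop) :
    fits s e -> run (if den s e != 0 then c1 else c2) s t Q ->
  run (If e c1 c2) s t.+1 Q.
Proof.
move=> /eval_fits ev [u [s' [ex le Qs]]].
by exists u.+1, s'; split=> //; apply: ExecIf ev ex.
Qed.

Lemma run_stop e c s t (Q : state -> Prop) :
  fits s e -> den s e = 0 -> Q s -> run (While e c) s t.+1 Q.
Proof.
move=> /eval_fits ev e0 Qs; exists 1, s; split=> //.
by apply: ExecWhileStop; rewrite ev e0.
Qed.

Lemma run_step e c s t1 t2 (Q : state -> Prop) :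
    fits s e -> den s e != 0 -> run c s t1 (fun s1 => run (While e c) s1 t2 Q) ->
  run (While e c) s (t1 + t2).+1 Q.
Proof.
move=> /eval_fits ev e0 [u1 [s1 [ex1 le1 [u2 [s2 [ex2 le2 Qs]]]]]].
exists (u1 + u2).+1, s2; split=> //; first exact: ExecWhileStep ev e0 ex1 ex2.
by rewrite ltnS leq_add.
Qed.
End Runs.

(** * Encoded lists in memory *)

Definition stored (f : nat -> nat) (a : nat) (w : seq nat) : Prop :=
  forall i, i < size w -> f (a + i) = nth 0 w i.

Lemma stored_cat f a u v :
  stored f a (u ++ v) <-> stored f a u /\ stored f (a + size u) v.
Proof.
split=> [st|[stu stv] i].
  split=> i lti.
    by rewrite st ?size_cat ?nth_cat ?lti // ltn_addr.
  by rewrite -addnA st ?size_cat ?ltn_add2l // nth_cat ltnNge leq_addr addKn.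
rewrite size_cat nth_cat; case: (ltnP i (size u)) => [lti _|lei lti]; first exact: stu.
by rewrite -stv ?ltn_subLR // -addnA subnKC.
Qed.

Lemma stored_eq f g a w :
  (forall i, a <= i < a + size w -> g i = f i) -> stored f a w -> stored g a w.
Proof.
by move=> fg st i lti; rewrite fg ?st // leq_addr ltn_add2l.
Qed.

Definition offset (ls : seq (seq nat)) (i : nat) := size (flatten (take i ls)).

Lemma offset_size ls : offset ls (size ls) = size (flatten ls).
Proof. by rewrite /offset take_size. Qed.

Lemma offsetS ls i : offset ls i.+1 = offset ls i + size (nth [::] ls i).
Proof.
rewrite /offset; case: (ltnP i (size ls)) => lti.
  by rewrite (take_nth [::]) // flatten_rcons size_cat.
by rewrite nth_default // addn0 !take_oversize // leqW.
Qed.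

Lemma offset_leq ls i : offset ls i <= size (flatten ls).
Proof. by rewrite -{2}(cat_take_drop i ls) flatten_cat size_cat leq_addr. Qed.

Lemma nth_offsets ls i : i <= size ls ->
  nth 0 (0 :: scanl addn 0 (shape ls)) i = offset ls i.
Proof.
case: i => [|i] lei /=; first by rewrite /offset take0.
rewrite (nth_scanl 0) ?size_map // /offset size_flatten /shape map_take.
(* The fold is computed from an arbitrary starting value, which is why 0 is first added on the
   right. *)
set s := take _ _; rewrite -[RHS]add0n; elim: s {lei} 0 => [|x s IH] a /=.
  by rewrite addn0.
by rewrite IH addnA.
Qed.

Lemma stored_lists f a ls :
  stored f a (encode_lists ls) <->
  [/\ f a = size ls,
      forall i, i <= size ls -> f (a + 1 + i) = offset ls i
    & stored f (a + 2 + size ls) (flatten ls)].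
Proof.
have -> : encode_lists ls =
    [:: size ls] ++ (0 :: scanl addn 0 (shape ls)) ++ flatten ls by [].
have sz : size (0 :: scanl addn 0 (shape ls)) = (size ls).+1.
  by rewrite /= size_scanl size_map.
rewrite !stored_cat sz; have -> : a + size [:: size ls] = a + 1 by [].
have -> : a + 1 + (size ls).+1 = a + 2 + size ls by lia.
split=> [[st0 [st1 st2]]|[st0 st1 st2]].
  split=> // [|i lei]; first by rewrite -[a]addn0 st0.
  by rewrite st1 ?sz // nth_offsets.
split; first by case=> // _; rewrite addn0.
by split=> // i; rewrite sz ltnS => lei; rewrite st1 // nth_offsets.
Qed.

Lemma stored_nth f a ls i :
    i < size ls -> stored f a (flatten ls) ->
  stored f (a + offset ls i) (nth [::] ls i).
Proof.
move=> lti; rewrite -{1}(cat_take_drop i ls) (drop_nth [::]) // flatten_cat /=.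
by rewrite !stored_cat => -[_ []].
Qed.

Lemma size_encode ls : size (encode_lists ls) = 2 + size ls + size (flatten ls).
Proof. by rewrite /= size_cat size_scanl size_map. Qed.

(** * The program *)

Arguments upd f x v y /.

Definition add_reg (x y : nat) := Bin Add (Reg x) (Reg y).

(* Registers 1-12 hold the constants [params] below.  The other ones are:
   16 current node, 17 its stamp, 18 remaining radius, 19 and 20 bounds of the
   current frontier, 21 end of the queue, 22 and 23 bounds of the list being
   read, 24 current vertex. *)
Definition scan_cmd : cmd :=
  While (Bin Minus (Reg 23) (Reg 22))
    (Seq (Set_ 24 (Fetch (Reg 22)))
    (Seq (If (Bin Eqn (Fetch (add_reg 9 24)) (Reg 17)) Skip
             (Seq (Store (add_reg 9 24) (Reg 17))
             (Seq (Store (Reg 21) (Reg 24))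
                  (Set_ 21 (Bin Add (Reg 21) (Cst 1))))))
         (Set_ 22 (Bin Add (Reg 22) (Cst 1))))).

(** The adjacency lists are encoded from address 1 on, after [d], so cells [2 + v] and [3 + v] hold
    the offsets that delimit the list of [v]. The loop test is a truncated difference, which
    vanishes once the frontier is exhausted. *)
Definition expand_cmd : cmd :=
  While (Bin Minus (Reg 20) (Reg 19))
    (Seq (Set_ 24 (Fetch (Reg 19)))
    (Seq (Set_ 22 (Bin Add (Reg 3) (Fetch (Bin Add (Cst 2) (Reg 24)))))
    (Seq (Set_ 23 (Bin Add (Reg 3) (Fetch (Bin Add (Cst 3) (Reg 24)))))
    (Seq scan_cmd
         (Set_ 19 (Bin Add (Reg 19) (Cst 1))))))).

(** The product of the two comparisons is their conjunction; the second one is the early stop of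
    [bfs]. After [expand_cmd], register 19 has reached the former end of the queue, where the next
    frontier begins. *)
Definition bfs_cmd : cmd :=
  While (Bin Mul (Bin Leqn (Cst 1) (Reg 18))
                 (Bin Leqn (Bin Add (Reg 19) (Cst 1)) (Reg 21)))
    (Seq (Set_ 20 (Reg 21))
    (Seq expand_cmd
         (Set_ 18 (Bin Minus (Reg 18) (Cst 1))))).

(** The stamp of a node is its number plus one, hence never the 0 initially found in the mark
    cells. *)
Definition bags_cmd : cmd :=
  While (Bin Minus (Reg 5) (Reg 16))
    (Seq (Set_ 17 (Bin Add (Reg 16) (Cst 1)))
    (Seq (Store (Bin Add (add_reg 10 16) (Cst 1)) (Bin Minus (Reg 21) (Reg 11)))
    (Seq (Set_ 19 (Reg 21))
    (Seq (Set_ 22 (Bin Add (Reg 7) (Fetch (Bin Add (add_reg 6 16) (Cst 1)))))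
    (Seq (Set_ 23 (Bin Add (Reg 7) (Fetch (Bin Add (add_reg 6 16) (Cst 2)))))
    (Seq scan_cmd
    (Seq (Set_ 18 (Reg 12))
    (Seq bfs_cmd
         (Set_ 16 (Bin Add (Reg 16) (Cst 1))))))))))).

Definition layers_cmd : cmd :=
  While (Bin Minus (Reg 9) (Reg 22))
    (Seq (Store (Reg 21) (Bin Div (Fetch (Reg 22)) (Reg 1)))
    (Seq (Set_ 21 (Bin Add (Reg 21) (Cst 1)))
         (Set_ 22 (Bin Add (Reg 22) (Cst 1))))).

Definition copy_cmd : cmd :=
  While (Bin Minus (Reg 21) (Reg 22))
    (Seq (Store (Reg 23) (Fetch (Reg 22)))
    (Seq (Set_ 22 (Bin Add (Reg 22) (Cst 1)))
         (Set_ 23 (Bin Add (Reg 23) (Cst 1))))).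

(** The address of each part of the input depends on the size of the previous one, which is read off
    as the last offset of its encoding. *)
Definition init_cmd : cmd :=
  Seq (Set_ 1 (Fetch (Cst 0)))
  (Seq (Set_ 2 (Fetch (Cst 1)))
  (Seq (Set_ 3 (Bin Add (Cst 3) (Reg 2)))
  (Seq (Set_ 4 (Bin Add (Reg 3) (Fetch (Bin Add (Cst 2) (Reg 2)))))
  (Seq (Set_ 5 (Fetch (Reg 4)))
  (Seq (Set_ 6 (Bin Add (Bin Add (Bin Add (Reg 4) (Cst 2)) (Reg 5))
                        (Fetch (Bin Add (Bin Add (Reg 4) (Cst 1)) (Reg 5)))))
  (Seq (Set_ 7 (Bin Add (Bin Add (Reg 6) (Cst 2)) (Reg 5)))
  (Seq (Set_ 8 (Bin Add (Reg 7) (Fetch (Bin Add (Bin Add (Reg 6) (Cst 1)) (Reg 5)))))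
  (Seq (Set_ 9 (add_reg 8 2))
  (Seq (Set_ 10 (add_reg 9 2))
  (Seq (Set_ 11 (Bin Add (Bin Add (Reg 10) (Cst 2)) (Reg 5)))
  (Seq (Set_ 12 (Bin Div (Reg 1) (Cst 2)))
       (Set_ 21 (Reg 11))))))))))))).

(* The new bags and layers are produced after the input, since the old ones are
   needed until the end; they are then moved down next to the tree, which is
   never read. *)
Definition power_cmd : cmd :=
  Seq init_cmd
  (Seq bags_cmd
  (Seq (Store (Bin Add (Bin Add (Reg 10) (Cst 1)) (Reg 5)) (Bin Minus (Reg 21) (Reg 11)))
  (Seq (Store (Reg 10) (Reg 5))
  (Seq (Set_ 22 (Reg 8))
  (Seq layers_cmd
  (Seq (Set_ 22 (Reg 10))
  (Seq (Set_ 23 (Reg 6))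
  (Seq copy_cmd
       (Set_ 0 (Reg 4)))))))))).

(** * Memory layout, invariants and running time of the program *)

Section Correctness.
Variables (W d : nat) (adj nbT bag : seq (seq nat)) (lay : seq nat).
Let n := size adj.
Let m := size nbT.
Hypothesis size_bag : size bag = m.
Hypothesis size_lay : size lay = n.

Definition input : seq nat :=
  d :: encode_lists adj ++ encode_lists nbT ++ encode_lists bag ++ lay.

(** The input ends at [adrV]. Behind it lie the [n] marks, then, from [adrF], the encoding of the
    new bags; its contents start at [adrQ] and are the successive search queues themselves. *)
Definition adrA := 3 + n.
Definition adrT := adrA + size (flatten adj).
Definition adrX := adrT + 2 + m + size (flatten nbT).
Definition adrXF := adrX + 2 + m.
Definition adrL := adrXF + size (flatten bag).
Definition adrV := adrL + n.
Definition adrF := adrV + n.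
Definition adrQ := adrF + 2 + m.

Definition params : seq nat :=
  [:: 0; d; n; adrA; adrT; m; adrX; adrXF; adrL; adrV; adrF; adrQ; d %/ 2].

Lemma size_input : size input = adrV.
Proof.
rewrite /input -cat1s !size_cat !size_encode size_bag size_lay.
rewrite /adrV /adrL /adrXF /adrX /adrT /adrA /= -/n -/m; lia.
Qed.

Record env (s : state) : Prop := Env {
  env_reg : forall x, x < 13 -> reg s x = nth 0 params x;
  env_mem : stored (memory s) 0 input }.

Lemma adr_order : [/\ adrA <= adrT, adrT <= adrX, adrX <= adrV,
   adrF = adrV + n & adrQ = adrF + 2 + m].
Proof. rewrite /adrQ /adrF /adrV /adrL /adrXF /adrX /adrT; split; lia. Qed.

Hypothesis adj_lt : forall v, all (gtn n) (nth [::] adj v).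
Hypothesis bag_lt : forall t, all (gtn n) (nth [::] bag t).
Hypothesis bag_uniq : forall t, uniq (nth [::] bag t).
(** The new bags take at most [m * n] cells from [adrQ] on, and the [n] new layers follow them. *)
Hypothesis W_room : adrQ + m * n + n + 8 < W.
Hypothesis W_input : forall i, nth 0 input i < W.

Lemma stored_input f : stored f 0 input ->
  [/\ f 0 = d, stored f 1 (encode_lists adj), stored f adrT (encode_lists nbT),
      stored f adrX (encode_lists bag) & stored f adrL lay].
Proof.
move=> st; have := st 0 isT; move: st; rewrite /input -cat1s !stored_cat.
move=> [_ [st1 [st2 [st3 st4]]]] st0.
rewrite !size_encode size_bag -/n -/m /= in st1 st2 st3 st4; split=> //.
- by move: st3; congr stored; rewrite /adrX /adrT /adrA; lia.
- by move: st4; congr stored; rewrite /adrL /adrXF /adrX /adrT /adrA; lia.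
Qed.

Lemma env_lt s a : env s -> a < adrV -> memory s a < W.
Proof. by move=> [_ st] lta; rewrite -[a]add0n st ?size_input. Qed.

(* Preserved: the registers below [b], and the memory except for the marks and
   the part of the output that starts at [a]. *)
Definition frame (b a : nat) (s s' : state) : Prop :=
  (forall x, x < b -> reg s' x = reg s x) /\
  (forall i, i < adrV \/ adrF <= i < a -> memory s' i = memory s i).

Lemma frame_refl b a s : frame b a s s. Proof. by []. Qed.
#[local] Hint Resolve frame_refl : core.

Lemma frame_trans b a s1 s2 s3 :
  frame b a s1 s2 -> frame b a s2 s3 -> frame b a s1 s3.
Proof.
move=> [r1 m1] [r2 m2]; split=> [x ltx|i lti]; first by rewrite r2 // r1.
by rewrite m2 // m1.
Qed.

Lemma frame_weaken b b' a s s' : b' <= b -> frame b a s s' -> frame b' a s s'.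
Proof. by move=> lb [r1 m1]; split=> // x ltx; apply/r1/(leq_trans ltx). Qed.

Lemma frame_env b a s s' : 13 <= b -> frame b a s s' -> env s -> env s'.
Proof.
move=> lb [r1 m1] [er em]; split=> [x ltx|]; first by rewrite r1 ?er // (leq_trans ltx).
by apply: stored_eq em => i; rewrite size_input add0n => /andP[_ lti]; apply: m1; left.
Qed.

(** [queue_mark] makes membership a test in constant time; [queue_old] makes every larger stamp
    fresh without clearing the marks, and bounds the marks that are read. *)
Record queue (tau a : nat) (Q : seq nat) (s : state) : Prop := Queue {
  queue_stamp : reg s 17 = tau;
  queue_end : reg s 21 = a + size Q;
  queue_stored : stored (memory s) a Q;
  queue_mark : forall v, v < n -> (memory s (adrV + v) == tau) = (v \in Q);
  queue_old : forall v, v < n -> memory s (adrV + v) <= tau;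
  queue_uniq : uniq Q;
  queue_lt : all (gtn n) Q }.

Lemma uniq_size_lt (Q : seq nat) : uniq Q -> all (gtn n) Q -> size Q <= n.
Proof.
move=> uQ /allP ltQ; rewrite -(size_iota 0 n); apply: uniq_leq_size => // v /ltQ.
by rewrite mem_iota.
Qed.

Lemma frame_set b a s x v : b <= x -> frame b a s (set_reg s x v).
Proof.
move=> lbx; split=> // y lty; rewrite /= /upd.
by have -> : (y == x) = false by lia.
Qed.

Lemma env_set s x v : 13 <= x -> env s -> env (set_reg s x v).
Proof. by move=> lx; apply: (frame_env (leqnn 13) (frame_set 0 s v lx)). Qed.

Lemma env_store s i v : adrV <= i -> env s -> env (set_mem s i v).
Proof.
move=> lei [er em]; split=> //; apply: stored_eq em => j; rewrite size_input.
by move=> /andP[_ ltj]; rewrite /= /upd; have -> : (j == i) = false by lia.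
Qed.

Lemma queue_set tau a Q s x v : (x != 17) && (x != 21) ->
  queue tau a Q s -> queue tau a Q (set_reg s x v).
Proof.
rewrite ![x == _]eq_sym => /andP[/negbTE x17 /negbTE x21] [*].
by split; rewrite /= /upd ?x17 ?x21.
Qed.

(** * The search that computes one new bag *)

Section OneBag.
Variables (tau a : nat).
Hypothesis tau_le : tau <= m.
Hypotheses (a_ge : adrQ <= a) (a_le : a <= adrQ + m * n).

Lemma push_run s Q v :
    env s -> queue tau a Q s -> reg s 24 = v -> v < n ->
  run W (If (Bin Eqn (Fetch (add_reg 9 24)) (Reg 17)) Skip
             (Seq (Store (add_reg 9 24) (Reg 17))
             (Seq (Store (Reg 21) (Reg 24))
                  (Set_ 21 (Bin Add (Reg 21) (Cst 1)))))) s 4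
    (fun s' => [/\ queue tau a (push Q v) s', frame 21 a s s'
                 & reg s' 22 = reg s 22 /\ reg s' 23 = reg s 23]).
Proof.
move=> es [q1 q2 q3 q4 q5 q6 q7] r24 ltv.
have [? ? ? eF eQ] := adr_order.
have szQ := uniq_size_lt q6 q7; have r9 := env_reg es (isT : 9 < 13).
have ov := q5 v ltv.
rewrite /= in r9; apply: run_if => /=; rewrite r9 r24 q1 ?q4 //.
  by repeat split; lia.
rewrite /push; case: (boolP (v \in Q)) => vQ /=.
  by apply: run_skip; split; [split|apply: frame_refl|].
rewrite (_ : 3 = 1 + (1 + 1)) //; apply: run_seq; apply: run_store => /=; rewrite ?r9 ?r24 ?q1.
- lia.
- lia.
apply: run_seq; apply: run_store => /=; rewrite ?q2 ?r24; [lia|lia|].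
apply: run_set => /=; rewrite ?q2; first by lia.
split; first split=> /=; rewrite /upd /= ?size_rcons ?addn1 ?addnS //.
- move=> i; rewrite size_rcons nth_rcons ltnS => lti.
  rewrite eqn_add2l; case: eqP => [->|ni]; first by rewrite ltnn.
  have lti' : i < size Q by lia.
  by rewrite lti' -q3 //; case: eqP => //; lia.
- move=> u ltu; have -> : (adrV + u == a + size Q) = false by lia.
  by rewrite eqn_add2l mem_rcons inE; case: (u == v); rewrite ?eqxx ?q4.
- move=> u ltu; have -> : (adrV + u == a + size Q) = false by lia.
  by case: ifP => // _; apply: q5.
- by rewrite rcons_uniq (negbTE vQ).
- by rewrite all_rcons /= ltv.
split=> [x ltx|i lti] /=; rewrite /upd.
  by have -> : (x == 21) = false by lia.
rewrite /upd.
have -> : (i == a + size Q) = false by lia.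
by have -> : (i == adrV + v) = false by lia.
Qed.

(** Seven units per entry: one for the test, one for the load, at most four for the push, one for
    the increment; the last unit is the failing test. The list lies below [adrV], where pushing
    writes nothing. *)
Lemma scan_run ls j s Q :
    env s -> queue tau a Q s -> reg s 22 = j -> reg s 23 = j + size ls ->
    j + size ls <= adrV -> stored (memory s) j ls -> all (gtn n) ls ->
  run W scan_cmd s (7 * size ls + 1)
    (fun s' => queue tau a (scan Q ls) s' /\ frame 21 a s s').
Proof.
have [oA oT oX oV oF] := adr_order.
elim: ls j s Q => [|v ls IH] j s Q es qs r22 r23 lej st ltls.
  apply: run_stop => /=; rewrite ?r22 ?r23 /= ?addn0 ?subnn //.
  by repeat split; lia.
have sv := st 0 isT; rewrite addn0 /= in sv r23 lej ltls; case/andP: ltls => ltv ltls.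
rewrite /= (_ : 7 * _ + 1 = (1 + (4 + 1) + (7 * size ls + 1)).+1); last by lia.
apply: run_step => /=; rewrite ?r22 ?r23; [by repeat split; lia|by lia|].
apply: run_seq; apply: run_set; rewrite /= ?r22 ?sv; first by lia.
set s1 := set_reg s 24 v.
have es1 : env s1 by apply: env_set.
have qs1 : queue tau a Q s1 by apply: queue_set.
apply: run_seq; apply: run_weaken (push_run es1 qs1 _ ltv) _ _ => // s2 [qs2 fr2 [r22' r23']].
rewrite /= /upd /= r22 r23 in r22' r23'.
apply: run_set => /=; rewrite r22'; first by lia.
set s3 := set_reg s2 22 (j + 1).
have fr3 : frame 21 a s s3.
  apply: frame_trans (frame_set a s v (isT : 21 <= 24)) _.
  exact: frame_trans fr2 (frame_set a _ _ (isT : 21 <= 22)).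
apply: run_weaken (IH (j + 1) s3 (push Q v) _ _ _ _ _ _ _) _ _ => //.
- exact: frame_env fr3 es.
- exact: queue_set.
- by rewrite /= /upd /= r23' addnS addn1.
- by lia.
- move: st; rewrite -cat1s stored_cat => -[_]; apply: stored_eq => i; rewrite /= => lti.
  by case: fr3 => _ ->; [|left; lia].
by move=> s4 [qs4 fr4]; split=> //; apply: frame_trans fr3 fr4.
Qed.

Lemma neighbours_stored s v : env s -> v < n ->
  [/\ memory s (2 + v) = offset adj v, memory s (3 + v) = offset adj v.+1,
      adrA + offset adj v.+1 <= adrV
    & stored (memory s) (adrA + offset adj v) (nth [::] adj v)].
Proof.
have [oA oT oX oV oF] := adr_order.
move=> es ltv; have [_ /stored_lists[_ off fl] _ _ _] := stored_input (env_mem es).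
split; first by rewrite -off ?(ltnW ltv).
- by rewrite -off //; congr (memory s _); lia.
- have le : offset adj v.+1 <= size (flatten adj).
    exact: offset_leq.
  by rewrite (leq_trans _ (leq_trans oT oX)) // /adrT leq_add2l.
- by have -> : adrA = 1 + 2 + size adj by []; apply: stored_nth.
Qed.

(** The queue is cut into a part [P] already passed, the part [F] of the frontier still to be read,
    and the rest [R]. Discoveries only lengthen [R], so [F] stays in place while the induction moves
    its head to the end of [P]. *)
Lemma expand_run F P R s :
    env s -> queue tau a (P ++ F ++ R) s ->
    reg s 19 = a + size P -> reg s 20 = a + size P + size F ->
  run W expand_cmd s (sumn [seq 7 * size (nth [::] adj v) + 6 | v <- F] + 1)
    (fun s' => [/\ queue tau a (expand (nth [::] adj) (P ++ F ++ R) F) s',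
                  frame 19 a s s' & reg s' 19 = a + size P + size F]).
Proof.
have [oA oT oX oV oF] := adr_order.
elim: F P R s => [|v F IH] P R s es qs r19 r20.
  have szQ := uniq_size_lt (queue_uniq qs) (queue_lt qs).
  rewrite size_cat in szQ.
  apply: run_stop => /=; rewrite ?r19 ?r20 /= ?addn0 ?subnn //.
  by repeat split; lia.
have szQ := uniq_size_lt (queue_uniq qs) (queue_lt qs).
rewrite !size_cat /= in szQ r20.
have ltv : v < n by have := queue_lt qs; rewrite !all_cat /= => /and3P[_ /andP[]].
have sv : memory s (a + size P) = v.
  by have [+ _] := (stored_cat _ _ _ _).1 (((stored_cat _ _ _ _).1 (queue_stored qs)).2) => /(_ 0 isT); rewrite addn0.
have [o1 o2 o3 st] := neighbours_stored es ltv.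
have szv := offsetS adj v.
set t := sumn _; have -> : t + 1 = (1 + (1 + (1 + (7 * size (nth [::] adj v) + 1 + 1)))
   + (sumn [seq 7 * size (nth [::] adj v) + 6 | v <- F] + 1)).+1.
  by rewrite /t /=; lia.
apply: run_step => /=; rewrite ?r19 ?r20; [by repeat split; lia|by lia|].
apply: run_seq; apply: run_set; rewrite /= ?r19 ?sv; first by lia.
set s1 := set_reg s 24 v.
have es1 : env s1 by apply: env_set.
apply: run_seq; apply: run_set.
  rewrite /= /upd /= o1 (env_reg es (isT : 3 < 13)) /=; lia.
rewrite /= /upd /= o1 (env_reg es (isT : 3 < 13)) /=.
set s2 := set_reg _ 22 _.
have es2 : env s2 by apply: env_set.
apply: run_seq; apply: run_set.
  rewrite /= /upd /= o2 (env_reg es (isT : 3 < 13)) /=; lia.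
rewrite /= /upd /= o2 (env_reg es (isT : 3 < 13)) /=.
set s3 := set_reg _ 23 _.
have es3 : env s3 by apply: env_set.
have fr3 : frame 21 a s s3 by do 3! apply: frame_trans (frame_set _ _ _ _) => //.
apply: run_seq; apply: run_weaken (scan_run es3 _ (erefl _) _ _ _ _) _ _ => //.
- by do 3! apply: queue_set => //; exact: qs.
- by rewrite /= /upd /=; lia.
- by rewrite /= /upd /=; lia.
- exact: st.
move=> s4 [qs4 fr4].
have r19' : reg s4 19 = a + size P by case: fr4 => -> //.
have r20' : reg s4 20 = a + (size P + (size F).+1) by case: fr4 => -> //; rewrite /= /upd /=; lia.
apply: run_set => /=; rewrite r19'; first by lia.
set s5 := set_reg _ _ _.
have fr5 : frame 19 a s s5.
  apply: frame_trans (frame_set _ _ _ _) => //.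
  exact: frame_weaken (frame_trans fr3 fr4).
have es5 : env s5 by apply: frame_env fr5 es.
have qs5 := queue_set (x := 19) (a + size P + 1) isT qs4.
rewrite -/s5 in qs5.
have [R' eR'] := scan_prefix (P ++ (v :: F) ++ R) (nth [::] adj v).
have eQ : (P ++ (v :: F) ++ R) ++ R' = rcons P v ++ F ++ (R ++ R').
  by rewrite -cats1 -!catA.
rewrite eR' eQ in qs5.
apply: run_weaken (IH (rcons P v) (R ++ R') s5 es5 qs5 _ _) _ _ => //.
- by rewrite size_rcons /= /upd /=; lia.
- by rewrite size_rcons /= /upd /=; lia.
move=> s6 [qs6 fr6 r6]; split=> /=; first by rewrite eR' eQ.
- exact: frame_trans fr5 fr6.
- by rewrite r6 size_rcons; lia.
Qed.

(** This is four units per vertex more than an expansion takes. They pay for the overhead of a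
    round, which is entered only if its frontier has at least one vertex. *)
Definition cost (F : seq nat) :=
  sumn [seq 7 * size (nth [::] adj v) + 10 | v <- F].

(** Frontiers are disjoint consecutive pieces of the final queue from [lo] on, so their costs add up
    to at most the cost of that part, uniformly in [r]. *)
Lemma bfs_run r lo Q s :
    env s -> queue tau a Q s -> r < W -> lo <= size Q ->
    reg s 18 = r -> reg s 19 = a + lo ->
  run W bfs_cmd s (cost (drop lo (bfs (nth [::] adj) r lo Q)) + 1)
    (fun s' => queue tau a (bfs (nth [::] adj) r lo Q) s' /\ frame 18 a s s').
Proof.
have [oA oT oX oV oF] := adr_order.
elim: r lo Q s => [|r IH] lo Q s es qs ltr lelo r18 r19.
  have szQ := uniq_size_lt (queue_uniq qs) (queue_lt qs).
  have := queue_end qs => r21.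
  rewrite addn1; apply: run_stop => /=.
  - by rewrite r18 r19 r21; repeat split; lia.
  - by rewrite r18.
  - by split.
have szQ := uniq_size_lt (queue_uniq qs) (queue_lt qs).
have := queue_end qs => r21 /=.
case: ltnP => [ltlo|gelo]; last first.
  rewrite addn1; apply: run_stop => /=.
  - by rewrite r18 r19 r21; repeat split; lia.
  - by rewrite r18 r19 r21; lia.
  - by split.
set F := drop lo Q; set Q' := expand _ Q F; set Q'' := bfs _ _ _ _.
have [R1 e1] := expand_prefix (nth [::] adj) Q F.
have [R2 e2] := bfs_prefix (nth [::] adj) r (size Q) Q'.
have costE : cost (drop lo Q'') = cost F + cost (drop (size Q) Q'').
  rewrite /Q'' e2 /Q' e1 -catA [in RHS]drop_size_cat // drop_cat ltlo -/F.
  by rewrite /cost map_cat sumn_cat.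
have ltF : 0 < size F by rewrite size_drop; lia.
have costF : sumn [seq 7 * size (nth [::] adj v) + 6 | v <- F] + 4 <= cost F.
  rewrite /cost; case: (F) ltF => //= v F' _.
  suff : sumn [seq 7 * size (nth [::] adj v) + 6 | v <- F'] <=
         sumn [seq 7 * size (nth [::] adj v) + 10 | v <- F'] by lia.
  by elim: F' => //= u F' IHF; lia.
set t := sumn _ in costF.
apply: (@run_weaken _ _ _ ((1 + (t + 1 + 1)) + (cost (drop (size Q) Q'') + 1)).+1);
  [|by rewrite costE; lia|by move=> ? H; exact: H].
apply: run_step => /=; rewrite ?r18 ?r19 ?r21.
- by repeat split; lia.
- by lia.
apply: run_seq; apply: run_set; rewrite /= ?r21; first by lia.
set s1 := set_reg _ _ _.
have es1 : env s1 by apply: env_set.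
have eQ : take lo Q ++ F ++ [::] = Q by rewrite cats0 cat_take_drop.
have szlo : size (take lo Q) = lo by rewrite size_takel.
have szF : lo + size F = size Q by rewrite size_drop; lia.
apply: run_seq; apply: run_weaken (@expand_run F (take lo Q) [::] s1 es1 _ _ _) _ _ => //.
- by rewrite eQ; apply: queue_set.
- by rewrite szlo /= /upd /=.
- by rewrite szlo /= /upd /=; lia.
move=> s2; rewrite eQ szlo => -[qs2 fr2 r19'].
have r18' : reg s2 18 = r.+1 by case: fr2 => -> //.
apply: run_set; rewrite /= r18'; first by lia.
set s3 := set_reg _ _ _.
have fr3 : frame 18 a s s3.
  apply: frame_trans (frame_set _ _ _ _) => //.
  exact: frame_weaken (frame_trans (frame_set a _ _ (isT : 19 <= 20)) fr2).
apply: run_weaken (IH (size Q) Q' s3 _ _ _ _ _ _) _ _ => //.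
- exact: frame_env fr3 es.
- exact: queue_set.
- exact: ltnW.
- by rewrite /Q' e1 size_cat leq_addr.
- by rewrite /= /upd /=; lia.
- by rewrite /= /upd /= r19'; lia.
by move=> s4 [qs4 fr4]; split=> //; apply: frame_trans fr3 fr4.
Qed.
End OneBag.

(** * The loop over the nodes of the tree *)

Definition new_bags :=
  [seq bfs (nth [::] adj) (d %/ 2) 0 (scan [::] b) | b <- bag].

(** An old bag has at most [n] entries to scan, and a search meets each of the [n] vertices at most
    once; the constant covers the rest of the loop body. *)
Definition bag_time := 7 * n + cost (iota 0 n) + 12.

Lemma nth_new_bags t : t < m -> nth [::] new_bags t =
  bfs (nth [::] adj) (d %/ 2) 0 (scan [::] (nth [::] bag t)).
Proof. by rewrite -size_bag => ltt; rewrite (nth_map [::]). Qed.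

Lemma new_bag_uniq_lt t :
  uniq (nth [::] new_bags t) /\ all (gtn n) (nth [::] new_bags t).
Proof.
case: (ltnP t m) => [ltt|let_]; last first.
  by rewrite nth_default // size_map size_bag.
rewrite nth_new_bags //; split; first exact/bfs_uniq/scan_uniq.
apply: all_bfs => [u _|]; first exact: adj_lt.
by apply/allP => v; rewrite mem_scan => /(allP (bag_lt t)).
Qed.

Lemma new_bag_size t : size (nth [::] new_bags t) <= n.
Proof. by have [*] := new_bag_uniq_lt t; apply: uniq_size_lt. Qed.

Lemma cost_le (Q : seq nat) : uniq Q -> all (gtn n) Q -> cost Q <= cost (iota 0 n).
Proof.
move=> uQ /allP ltQ; rewrite /cost !sumnE !big_map.
apply: (@uniq_sub_le_big _ addn leq leqnn (fun x y => leq_addr y x)) => //.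
  exact: iota_uniq.
by move=> v /ltQ; rewrite mem_iota.
Qed.

Lemma offset_new_bags t : offset new_bags t <= t * n.
Proof.
elim: t => [|t IH]; first by rewrite /offset take0.
by rewrite offsetS mulSn addnC leq_add // new_bag_size.
Qed.

(** Only offsets of index below [t] are present: that of node [t] is stored when its own round
    starts, and the final one after the loop. *)
Record bags_inv (t : nat) (s : state) : Prop := BagsInv {
  bags_env : env s;
  bags_node : reg s 16 = t;
  bags_end : reg s 21 = adrQ + offset new_bags t;
  bags_mark : forall v, v < n -> memory s (adrV + v) <= t;
  bags_offset : forall i, i < t -> memory s (adrF + 1 + i) = offset new_bags i;
  bags_stored : stored (memory s) adrQ (flatten (take t new_bags)) }.

Lemma bags_run t s : t <= m -> bags_inv t s ->
  run W bags_cmd s ((m - t) * bag_time + 1) (bags_inv m).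
Proof.
have [oA oT oX oV oF] := adr_order.
have [k eqk] : exists k, k = m - t by exists (m - t).
elim: k t s eqk => [|k IH] t s eqk let_ [es r16 r21 mk off st].
  have et : t = m by lia.
  rewrite addn1; apply: run_stop; rewrite /= ?r16 ?(env_reg es (isT : 5 < 13)) /= ?et.
  - by repeat split; lia.
  - by rewrite subnn.
  - by rewrite -et.
have ltt : t < m by lia.
have tn := offset_new_bags t.
have tnm : t * n + n <= m * n by rewrite addnC -mulSn leq_mul2r ltt orbT.
set a := adrQ + offset new_bags t in r21.
have a_ge : adrQ <= a by apply: leq_addr.
have a_le : a <= adrQ + m * n by rewrite leq_add2l; lia.
set b := nth [::] bag t.
set Q := nth [::] new_bags t.
have [uQ ltQ] : uniq Q /\ all (gtn n) Q by apply: new_bag_uniq_lt.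
have szQ : size Q <= n by apply: new_bag_size.
have szb : size b <= n by apply: uniq_size_lt; [apply: bag_uniq | apply: bag_lt].
have costQ := cost_le uQ ltQ.
have [_ _ _ /stored_lists[_ offX stX] _] := stored_input (env_mem es).
rewrite size_bag in offX stX.
have {}stX : stored (memory s) (adrXF + offset bag t) b.
  by apply: stored_nth; rewrite ?size_bag.
have offb := offsetS bag t; rewrite -/b in offb.
have leX : adrXF + offset bag t.+1 <= adrV.
  by rewrite /adrV /adrL -addnA leq_add2l (leq_trans (offset_leq _ _)) ?leq_addr.
have eXF : adrXF = adrX + 2 + m by [].
have o1 : memory s (adrX + t + 1) = offset bag t.
  by rewrite -offX 1?ltnW //; congr (memory s _); lia.
have o2 : memory s (adrX + t + 2) = offset bag t.+1.
  by rewrite -offX //; congr (memory s _); lia.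
apply: (@run_weaken _ _ _ ((1 + (1 + (1 + (1 + (1 + ((7 * size b + 1) +
   (1 + ((cost Q + 1) + 1)))))))) + ((m - t.+1) * bag_time + 1)).+1 _ (bags_inv m)) => //; last first.
  by rewrite -eqk (_ : m - t.+1 = k) ?mulSn /bag_time; lia.
apply: run_step; rewrite /= ?r16 ?(env_reg es (isT : 5 < 13)) /=; [by repeat split; lia|by lia|].
apply: run_seq; apply: run_set; rewrite /= ?r16; first by lia.
set s1 := set_reg _ _ _.
have es1 : env s1 by apply: env_set.
apply: run_seq; apply: run_store.
- by rewrite /= /upd /= r16 (env_reg es (isT : 10 < 13)) /=; lia.
- by rewrite /= /upd /= r21 (env_reg es (isT : 11 < 13)) /= -/a; lia.
rewrite /= /upd /= r16 r21 (env_reg es (isT : 10 < 13)) (env_reg es (isT : 11 < 13)) /=.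
rewrite addKn.
set s2 := set_mem _ _ _.
have es2 : env s2 by apply: env_store => //; lia.
have mk2 v : v < n -> memory s2 (adrV + v) <= t.
  move=> ltv; rewrite /= /upd; have -> : (adrV + v == adrF + t + 1) = false by lia.
  exact: mk.
have off2 i : i < t.+1 -> memory s2 (adrF + 1 + i) = offset new_bags i.
  rewrite /= /upd; case: eqP => [ei|ni lti]; last by apply: off; lia.
  by have -> : i = t by lia.
have st2 : stored (memory s2) adrQ (flatten (take t new_bags)).
  apply: stored_eq st => i /andP[lei _]; rewrite /= /upd.
  by have -> : (i == adrF + t + 1) = false by lia.
have stX2 : stored (memory s2) (adrXF + offset bag t) b.
  apply: stored_eq stX => i /andP[_ lti]; rewrite /= /upd.
  by have -> : (i == adrF + t + 1) = false by lia.
apply: run_seq; apply: run_set; rewrite /= /upd /= ?r21; first by lia.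
apply: run_seq; apply: run_set; rewrite /= /upd /= r16 (env_reg es (isT : 7 < 13))
  (env_reg es (isT : 6 < 13)) /= (_ : (_ == _) = false) ?o1; try lia.
apply: run_seq; apply: run_set; rewrite /= /upd /= r16 (env_reg es (isT : 7 < 13))
  (env_reg es (isT : 6 < 13)) /= (_ : (_ == _) = false) ?o2; try lia.
set s3 := set_reg _ 23 _.
have es3 : env s3 by do 3! apply: env_set => //.
have fr3 : frame 18 a s2 s3 by do 3! apply: frame_trans (frame_set _ _ _ _) => //.
(* All marks are at most [t], so none equals the new stamp [t + 1] and the queue of this node starts
   empty. *)
have qs3 : queue t.+1 a [::] s3.
  split=> //.
  - by rewrite /= /upd /= addn1.
  - by rewrite /= /upd /= r21 addn0.
  - move=> v ltv; apply: negbTE; apply: contraTneq (mk2 v ltv) => e.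
    by rewrite -ltnNge -e.
  - by move=> v ltv; apply/leqW/mk2.
apply: run_seq.
apply: run_weaken (scan_run ltt a_ge a_le es3 qs3 (erefl _) _ _ stX2 (bag_lt t)) _ _ => //.
- by rewrite /= /upd /= -/b; lia.
- by rewrite /= /upd /= -/b; lia.
move=> s4 [qs4 fr4].
have es4 : env s4 by apply: frame_env fr4 es3.
have r19 : reg s4 19 = a by case: fr4 => -> //.
apply: run_seq; apply: run_set.
  rewrite /= (env_reg es4 (isT : 12 < 13)) /=; have := env_lt es (_ : 0 < adrV).
  have [-> _ _ _ _] := stored_input (env_mem es); have := leq_div d 2; lia.
rewrite /= (env_reg es4 (isT : 12 < 13)) /=.
set s5 := set_reg _ _ _.
have es5 : env s5 by apply: env_set.
have := @bfs_run t.+1 a ltt a_ge a_le (d %/ 2) 0 (scan [::] b) s5 es5.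
rewrite -nth_new_bags // -/Q drop0 => bfsP.
apply: run_seq; apply: run_weaken (bfsP _ _ _ _ _) _ _ => //.
- exact: queue_set.
- have := env_lt es (_ : 0 < adrV).
  have [-> _ _ _ _] := stored_input (env_mem es); have := leq_div d 2; lia.
- by rewrite /= /upd /= addn0.
move=> s6 [qs6 fr6].
have fr : frame 18 a s2 s6.
  apply: frame_trans fr3 _; apply: frame_trans (frame_weaken _ fr4) _ => //.
  exact: frame_trans (frame_set _ _ _ _) fr6.
have r16' : reg s6 16 = t by case: fr => -> //; rewrite /= /upd /=.
apply: run_set; rewrite /= r16'; first by lia.
set s7 := set_reg _ _ _.
have [_ fm] := fr.
apply: IH => //; first by lia.
split.
- by apply: env_set => //; apply: frame_env fr es2.
- by rewrite /= /upd /= addn1.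
- by rewrite /= /upd /= (queue_end qs6) offsetS -/Q; lia.
- exact: (queue_old qs6).
- by move=> i lti; rewrite /= fm ?off2 //; right; lia.
- rewrite (take_nth [::]) ?size_map ?size_bag // flatten_rcons stored_cat; split.
    by apply: stored_eq st2 => i /andP[lei lti]; apply: fm; right; rewrite lti andbT; lia.
  exact: (queue_stored qs6).
Qed.

(** * New layers, final move, initialisation, and the whole program *)

Lemma layers_run ls j q s :
    env s -> reg s 22 = j -> j + size ls = adrV -> stored (memory s) j ls ->
    reg s 21 = q -> adrQ <= q -> q + size ls < W ->
  run W layers_cmd s (4 * size ls + 1)
    (fun s' => [/\ frame 16 q s s', reg s' 21 = q + size ls
                 & stored (memory s') q [seq v %/ d | v <- ls]]).
Proof.
have [oA oT oX oV oF] := adr_order.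
elim: ls j q s => [|v ls IH] j q s es r22 ej st r21 leq ltW /=.
  rewrite addn1; apply: run_stop; rewrite /= ?r22 ?(env_reg es (isT : 9 < 13)) /=.
  - by rewrite addn0 in ej; repeat split; lia.
  - by rewrite addn0 in ej; rewrite ej subnn.
  - by split=> //; rewrite addn0.
rewrite /= in ej ltW; have sv := st 0 isT; rewrite addn0 /= in sv.
have ltv : v < W by rewrite -sv; apply: env_lt es _; lia.
have [ed _ _ _ _] := stored_input (env_mem es).
have ltd : d < W by rewrite -ed; apply: env_lt es _; lia.
have ltvd := leq_div v d.
rewrite (_ : 4 * _ + 1 = (1 + (1 + 1) + (4 * size ls + 1)).+1); last by lia.
apply: run_step; rewrite /= ?r22 ?(env_reg es (isT : 9 < 13)) /=; try lia.
apply: run_seq; apply: run_store; rewrite /= ?r21 ?r22 ?sv ?(env_reg es (isT : 1 < 13)) /=; try lia.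
set s1 := set_mem _ _ _.
have es1 : env s1 by apply: env_store => //; lia.
apply: run_seq; apply: run_set; rewrite /= ?r21; first by lia.
apply: run_set; rewrite /= /upd /= ?r22; first by lia.
set s3 := set_reg _ _ _.
have es3 : env s3 by do 2! apply: env_set => //.
have st3 : stored (memory s3) (j + 1) ls.
  move: st; rewrite -cat1s stored_cat => -[_]; apply: stored_eq => i /= lti.
  by rewrite /upd; have -> : (i == q) = false by lia.
apply: run_weaken (IH (j + 1) (q + 1) s3 es3 _ _ st3 _ _ _) _ _ => //; try lia.
move=> s4 [[fr fm] r21' st4]; split.
- split=> [x ltx|i lti].
    rewrite fr //= /upd; have -> : (x == 22) = false by lia.
    by have -> : (x == 21) = false by lia.
  by rewrite fm //= /upd; [have -> : (i == q) = false|]; lia.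
- by rewrite r21'; lia.
rewrite -cat1s stored_cat; split=> // -[|//] _.
by rewrite addn0 fm /= /upd ?eqxx //; lia.
Qed.

(* The copy may overlap its source, which is above its target. *)
Lemma copy_run w i j s :
    reg s 21 = i + size w -> reg s 22 = i -> reg s 23 = j -> j <= i ->
    i + size w < W -> all (gtn W) w -> stored (memory s) i w ->
  run W copy_cmd s (4 * size w + 1)
    (fun s' => [/\ forall x, x < 16 -> reg s' x = reg s x,
                  forall a, a < j -> memory s' a = memory s a
                & stored (memory s') j w]).
Proof.
elim: w i j s => [|v w IH] i j s r21 r22 r23 leji ltW ltw st /=.
  rewrite addn1; apply: run_stop; rewrite /= ?r21 ?r22 /= ?addn0 ?subnn //.
  by rewrite addn0 in ltW; repeat split; lia.
rewrite /= in r21 ltW ltw; case/andP: ltw => ltv ltw.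
have sv := st 0 isT; rewrite addn0 /= in sv.
rewrite (_ : 4 * _ + 1 = (1 + (1 + 1) + (4 * size w + 1)).+1); last by lia.
apply: run_step; rewrite /= ?r21 ?r22; try lia.
apply: run_seq; apply: run_store; rewrite /= ?r22 ?r23 ?sv; try lia.
apply: run_seq; apply: run_set; rewrite /= ?r22; first by lia.
apply: run_set; rewrite /= /upd /= ?r23; first by lia.
set s3 := set_reg _ _ _.
have st3 : stored (memory s3) (i + 1) w.
  move: st; rewrite -cat1s stored_cat => -[_]; apply: stored_eq => k /= ltk.
  by rewrite /upd; have -> : (k == j) = false by lia.
apply: run_weaken (IH (i + 1) (j + 1) s3 _ _ _ _ _ ltw st3) _ _ => //; try lia.
  by rewrite /= /upd /= r21; lia.
move=> s4 [fr fm st4]; split.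
- move=> x ltx; rewrite fr //= /upd; have -> : (x == 22) = false by lia.
  by have -> : (x == 23) = false by lia.
- by move=> a lta; rewrite fm /= /upd; [have -> : (a == j) = false|]; lia.
rewrite -cat1s stored_cat; split=> // -[|//] _.
by rewrite addn0 fm /= /upd ?eqxx //; lia.
Qed.

Lemma init_run s : (forall x, reg s x = 0) -> memory s =1 nth 0 input ->
  run W init_cmd s 13 (bags_inv 0).
Proof.
move=> s0 sm; have [oA oT oX oV oF] := adr_order.
have lt0 : 0 < W by lia.
have st : stored (memory s) 0 input by move=> i _; apply: sm.
have [m0 m1 m2 m3 [m4 m5]] : [/\ memory s 0 = d, memory s 1 = n,
    memory s (2 + n) = size (flatten adj), memory s adrT = m
  & memory s (adrT + 1 + m) = size (flatten nbT)
    /\ memory s (adrX + 1 + m) = size (flatten bag)].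
  have [-> /stored_lists[-> oG _] /stored_lists[-> oN _] /stored_lists[_ oB _] _] :=
    stored_input st.
  rewrite size_bag in oB.
  by split; rewrite // -?offset_size -?oG ?oN ?size_bag ?oB.
have ltd : d < W by rewrite -m0 sm.
have e4 : adrT = adrA + size (flatten adj) by [].
have e6 : adrX = adrT + 2 + m + size (flatten nbT) by [].
have e7 : adrXF = adrX + 2 + m by [].
have e8 : adrL = adrXF + size (flatten bag) by [].
have e9 : adrV = adrL + n by [].
have d2 := leq_div d 2.
rewrite (_ : 13 = 1 + (1 + (1 + (1 + (1 + (1 + (1 + (1 + (1 + (1 + (1 + (1 + 1)))))))))))) //.
apply: run_seq; apply: run_set; rewrite /= ?m0; first by lia.
apply: run_seq; apply: run_set; rewrite /= ?m1; first by lia.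
apply: run_seq; apply: run_set; rewrite /= /upd /= -/adrA; first by lia.
apply: run_seq; apply: run_set; rewrite /= /upd /= m2 -e4; first by lia.
apply: run_seq; apply: run_set; rewrite /= /upd /= m3; first by lia.
apply: run_seq; apply: run_set; rewrite /= /upd /= m4 -e6; first by lia.
apply: run_seq; apply: run_set; rewrite /= /upd /= -e7; first by lia.
apply: run_seq; apply: run_set; rewrite /= /upd /= m5 -e8; first by lia.
apply: run_seq; apply: run_set; rewrite /= /upd /= -e9; first by lia.
apply: run_seq; apply: run_set; rewrite /= /upd /= -oV; first by lia.
apply: run_seq; apply: run_set; rewrite /= /upd /= -oF; first by lia.
apply: run_seq; apply: run_set; rewrite /= /upd /=; first by lia.
apply: run_set; rewrite /= /upd /=; first by lia.
split=> //=; rewrite /upd /=.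
- by split=> //; case=> [|x] //=; do 12? case: x => [|x] //.
- by rewrite /offset take0 addn0.
(* The mark cells lie past the input, where the memory reads 0. *)
- by move=> v _; rewrite sm nth_default // size_input; lia.
- by rewrite take0.
Qed.

Definition output : seq nat :=
  encode_lists nbT ++ encode_lists new_bags ++ [seq v %/ d | v <- lay].

Definition power_time := m * bag_time + 4 * (m + m * n + n) + 4 * n + 40.

Lemma offset_new_bags_lt t : offset new_bags t < W.
Proof.
rewrite (leq_ltn_trans (offset_leq _ _)) // -offset_size size_map size_bag.
by rewrite (leq_ltn_trans (offset_new_bags m)) //; lia.
Qed.

(** Needed to move the output: each value copied must be a word. Offsets are at most [m * n],
    vertices are below [n], and a new layer index is at most an entry of the input. *)
Lemma output_lt : all (gtn W) (encode_lists new_bags ++ [seq v %/ d | v <- lay]).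
Proof.
have [oA oT oX oV oF] := adr_order.
have st : stored (nth 0 (encode_lists new_bags)) 0 (encode_lists new_bags) by [].
have [st0 off stw] := (stored_lists _ _ _).1 st.
rewrite all_cat; apply/andP; split; apply/allP => x.
  have -> : encode_lists new_bags =
      [:: m] ++ (0 :: scanl addn 0 (shape new_bags)) ++ flatten new_bags.
    by rewrite /encode_lists size_map size_bag.
  rewrite !mem_cat mem_seq1 => /or3P[/eqP->|/(nthP 0)[i lti <-]|/flattenP[b bin xb]] /=.
  - by lia.
  - by rewrite nth_offsets ?offset_new_bags_lt // -ltnS (leq_trans lti) //= size_scanl size_map.
  - have [i _ eb] := nthP [::] bin; have [_ /allP ltb] := new_bag_uniq_lt i.
    rewrite eb in ltb; have /= := ltb _ xb; lia.
case/mapP => v vin ->; have /(nthP 0)[i _ ev] : v \in input.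
  by rewrite /input inE !mem_cat vin !orbT.
by rewrite /= (leq_ltn_trans (leq_div v d)) // -ev W_input.
Qed.

Lemma power_run :
  run W power_cmd (init input) power_time (fun s => has_output s output).
Proof.
have [oA oT oX oV oF] := adr_order.
have le_off := offset_new_bags m.
have oL : adrV = adrL + n by [].
set w := encode_lists new_bags ++ [seq v %/ d | v <- lay].
have szw : size w = 2 + m + offset new_bags m + n.
  by rewrite size_cat size_encode !size_map size_lay size_bag -offset_size size_map size_bag.
apply: (@run_weaken _ _ _ (13 + ((m * bag_time + 1) + (1 + (1 + (1 + ((4 * n + 1) +
   (1 + (1 + ((4 * size w + 1) + 1))))))))) _ (fun s => has_output s output)) => //; last first.
  by rewrite /power_time szw; lia.
apply: run_seq; apply: run_weaken (@init_run (init input) _ _) _ _ => // s1 inv1.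
have := bags_run (leq0n m) inv1; rewrite subn0 => runb.
apply: run_seq; apply: run_weaken runb _ _ => // s2 [es2 _ r21 _ off st].
have offm := offset_size new_bags; rewrite size_map size_bag in offm.
rewrite take_oversize ?size_map ?size_bag // in st.
apply: run_seq; apply: run_store; rewrite /= ?r21 ?(env_reg es2 (isT : 5 < 13))
  ?(env_reg es2 (isT : 10 < 13)) ?(env_reg es2 (isT : 11 < 13)) /= ?addKn; try lia.
set s3 := set_mem _ _ _.
have es3 : env s3 by apply: env_store => //; lia.
apply: run_seq; apply: run_store; rewrite /= ?(env_reg es2 (isT : 5 < 13))
  ?(env_reg es2 (isT : 10 < 13)) /=; try lia.
set s4 := set_mem _ _ _.
have es4 : env s4 by apply: env_store => //; lia.
have st4 : stored (memory s4) adrF (encode_lists new_bags).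
  apply/stored_lists; rewrite size_map size_bag; split.
  - by rewrite /= /upd eqxx.
  - move=> i lei; rewrite /= /upd; have -> : (adrF + 1 + i == adrF) = false by lia.
    case: eqP => [ei|ni]; last by apply: off; lia.
    by have -> : i = m by lia.
  - rewrite -oF; apply: stored_eq st => i /andP[lei _]; rewrite /= /upd.
    have -> : (i == adrF) = false by lia.
    by have -> : (i == adrF + 1 + m) = false by lia.
have r21' : reg s4 21 = adrQ + offset new_bags m by [].
apply: run_seq; apply: run_set; rewrite /= ?(env_reg es2 (isT : 8 < 13)) /=; first by lia.
set s5 := set_reg _ _ _.
have es5 : env s5 by apply: env_set.
have [_ _ _ _ stL] := stored_input (env_mem es5).
apply: run_seq.
have := @layers_run lay adrL (adrQ + offset new_bags m) s5 es5 erefl _ stL r21' _ _.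
rewrite size_lay => runl.
apply: run_weaken (runl _ _ _) _ _ => //; try lia.
move=> s6 [fr6 r21'' st6].
have es6 : env s6 by apply: frame_env fr6 es5.
(* The layers were written directly behind the last new bag, so bags and layers form one block
   starting at [adrF]. *)
have st6w : stored (memory s6) adrF w.
  apply/stored_cat; split.
    apply: stored_eq st4 => i; rewrite size_encode size_map size_bag -offm => lti.
    by case: fr6 => _ -> //; right; lia.
  by rewrite size_encode size_map size_bag -offm !addnA -oF.
apply: run_seq; apply: run_set; rewrite /= ?(env_reg es6 (isT : 10 < 13)) /=; first by lia.
apply: run_seq; apply: run_set; rewrite /= /upd /= ?(env_reg es6 (isT : 6 < 13)) /=; first by lia.
set s7 := set_reg _ _ _.
apply: run_seq; apply: run_weaken (@copy_run w adrF adrX s7 _ _ _ _ _ _ _) _ _ => //; try lia.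
- by rewrite szw /= /upd /= r21''; lia.
- exact: output_lt.
move=> s8 [r8 m8 st8].
have es8 : reg s8 4 = adrT by rewrite r8 //= /upd /= (env_reg es6 (isT : 4 < 13)).
apply: run_set; rewrite /= es8; first by lia.
(* The block was copied to [adrX], the first cell after the tree, and the cells below it are intact;
   the output therefore begins with the tree at [adrT]. *)
have [_ _ stT _ _] := stored_input (env_mem es6).
rewrite /has_output /= /upd /= -/(stored (memory s8) adrT output).
apply/stored_cat; split.
  apply: stored_eq stT => i; rewrite size_encode -/m => /andP[_ lti].
  by apply: m8; rewrite (leq_trans lti) // /adrX; lia.
by move: st8; congr stored; rewrite size_encode /adrX -/m; lia.
Qed.
End Correctness.

(** * The decomposition of the power *)

Lemma dist_le_refl (G : sgraph) r (x : G) : dist_le r x x.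
Proof. by apply/dist_leP; exists [::]. Qed.

Lemma dist_le_trans (G : sgraph) r1 r2 (x y z : G) :
  dist_le r1 x y -> dist_le r2 y z -> dist_le (r1 + r2) x z.
Proof.
move=> /dist_leP[p [szp xp <-]] /dist_leP[q [szq yq <-]]; apply/dist_leP.
by exists (p ++ q); rewrite size_cat leq_add // cat_path xp yq last_cat.
Qed.

Lemma dist_le_weaken (G : sgraph) r r' (x y : G) :
  r <= r' -> dist_le r x y -> dist_le r' x y.
Proof.
move=> rr /dist_leP[p [szp xp lp]]; apply/dist_leP; exists p; split=> //.
exact: leq_trans rr.
Qed.

Lemma dist_le_layer (G : sgraph) (lay : G -> nat) r (x y : G) :
  layering lay -> dist_le r x y -> lay y <= lay x + r.
Proof.
move=> hlay /dist_leP[p [szp xp <-]].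
suff : lay (last x p) <= lay x + size p by lia.
elim: p x {szp} xp => [|y' p IH] x /=; first by rewrite addn0.
by case/andP=> /hlay[_ xy] /IH; lia.
Qed.

(** Turns the bound on a single layer into one on a block of layers, splitting off the last layer at
    each step. *)
Lemma card_window (V : finType) (f : V -> nat) (A : {set V}) k a N :
    (forall i, #|A :&: [set v | f v == i]| <= k) ->
  #|[set v in A | a <= f v < a + N]| <= N * k.
Proof.
move=> fib; elim: N => [|N IH].
  by rewrite leqn0 cards_eq0; apply/eqP/setP => v; rewrite !inE; lia.
rewrite -(cardsID [set v | f v == a + N]) mulSn leq_add //.
  apply: leq_trans (fib (a + N)); apply: subset_leq_card.
  by apply/subsetP => v; rewrite !inE => /andP[/andP[-> _]].
apply: leq_trans IH; apply: subset_leq_card; apply/subsetP => v; rewrite !inE.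
by move=> /andP[ne /andP[-> /=]]; lia.
Qed.

Section PowerDecomposition.
Variables (G T : sgraph) (X : T -> {set G}) (lay : G -> nat) (d k : nat).
Hypothesis d_gt0 : 0 < d.
Hypothesis ltw : witness_ltw G T X lay k.

Definition ball_bag (t : T) : {set power G d} :=
  [set y | [exists x in X t, dist_le (d %/ 2) x y]].

Definition power_layer (v : power G d) : nat := lay v %/ d.

Lemma ball_bagP (t : T) (y : G) :
  reflect (exists2 x, x \in X t & dist_le (d %/ 2) x y) (y \in ball_bag t).
Proof. by rewrite inE; apply: exists_inP. Qed.

(** The walk is cut after [r] steps. If nothing remains, any bag of [u] serves. Otherwise the next
    edge lies in an old bag, with [u] within [r] of its first end and [v] within [d - r - 1 <= r] of
    its second. *)
Lemma ball_bag_edge (u v : G) : dist_le d u v ->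
  exists t, (u \in ball_bag t) && (v \in ball_bag t).
Proof.
have [[_ cover edgeX _] _ _] := ltw; set r := d %/ 2.
move=> /dist_leP[p [szp up lp]].
have := cat_take_drop r p; case: (drop r p) (size_drop r p) => [|w' q] szq ep.
  have [t ut] := cover u; exists t; apply/andP; split; apply/ball_bagP; exists u => //.
    exact: dist_le_refl.
  apply/dist_leP; exists p; split=> //; rewrite /= -/r in szq *; lia.
move: up lp; rewrite -ep cat_path last_cat /= => /and3P[utp ww' w'q lq].
have [t /andP[wt w't]] := edgeX _ _ ww'; exists t; apply/andP; split; apply/ball_bagP.
  exists (last u (take r p)) => //; rewrite dist_le_sym; apply/dist_leP.
  by exists (take r p); rewrite size_take_min geq_minl.
by exists w' => //; apply/dist_leP; exists q; split=> //; rewrite /= in szq; lia.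
Qed.

Definition touching (u : G) : rel T :=
  fun a b => [&& edge a b, u \in ball_bag a & u \in ball_bag b].

Lemma touching_sym u : connect_sym (touching u).
Proof.
by apply: sym_connect_sym => a b; rewrite /touching edge_sym; congr andb; apply: andbC.
Qed.

Lemma connect_ball (u x : G) (s t : T) :
    dist_le (d %/ 2) x u -> x \in X s -> x \in X t ->
  connect (touching u) s t.
Proof.
have [[_ _ _ conn] _ _] := ltw => xu xs xt.
apply: connect_sub (conn x s t xs xt) => a b /and3P[ab xa xb]; apply: connect1.
by apply/and3P; split=> //; apply/ball_bagP; exists x.
Qed.

(** Every node is linked to one node [t0] whose old bag contains [u]. Along a short walk from a
    centre [x] to [u], each vertex stays within the radius of [u], and consecutive vertices share an
    old bag, where one passes from the subtree of the first to that of the second. *)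
Lemma ball_bag_connected (u : G) (s t : T) :
  u \in ball_bag s -> u \in ball_bag t -> connect (touching u) s t.
Proof.
have [[_ cover edgeX _] _ _] := ltw.
have [t0 ut0] := cover u.
have to_t0 s' : u \in ball_bag s' -> connect (touching u) s' t0.
  move=> /ball_bagP[x xs /dist_leP[p [szp xp lp]]].
  elim: p x s' xs szp xp lp => [|y p IH] x s' xs /= szp.
    by move=> _ xu; rewrite xu in xs; apply: connect_ball xs ut0; apply: dist_le_refl.
  move=> /andP[xy yp] lp; have [t1 /andP[xt1 yt1]] := edgeX _ _ xy.
  apply: connect_trans (IH y t1 yt1 (ltnW szp) yp lp).
  apply: connect_ball xs xt1; apply/dist_leP; exists (y :: p).
  by rewrite /= xy.
by move=> /to_t0 st /to_t0 tt; apply: connect_trans st _; rewrite touching_sym.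
Qed.

Lemma ball_bag_decomposition : tree_decomposition ball_bag.
Proof.
have [[treeT cover _ _] _ _] := ltw; split=> //.
- move=> u; have [t ut] := cover u; exists t; apply/ball_bagP.
  by exists u => //; apply: dist_le_refl.
- by move=> u v /andP[_ uv]; apply: ball_bag_edge.
- exact: ball_bag_connected.
Qed.

(** A walk of length at most [d] changes the old layer by at most [d], hence the block of [d] layers
    by at most one. *)
Lemma power_layering : layering power_layer.
Proof.
have [_ hlay _] := ltw => u v /andP[_ uv].
have near (x y : G) : dist_le d x y -> lay y %/ d <= (lay x %/ d).+1.
  move=> /(dist_le_layer hlay) /(leq_div2r d).
  by rewrite divnDr // divnn d_gt0 addn1.
by split; apply: near; rewrite // dist_le_sym.
Qed.

Lemma alpha_ball_bag t i :
  alpha (induced (ball_bag t :&: layer power_layer i)) <= (d + 2 * (d %/ 2)) * k.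
Proof.
have [_ hlay width] := ltw; set r := d %/ 2.
apply/bigmax_leqP => S stabS; case: (set_0Vmem S) => [->|[s0 _]].
  by rewrite cards0.
have inball (s : induced (ball_bag t :&: layer power_layer i)) :
    exists x, (x \in X t) && dist_le r x (val s).
  have := valP s; rewrite in_setI => /andP[/ball_bagP[x xt xs] _].
  by exists x; rewrite xt.
pose f s := xchoose (inball s).
have fP s : (f s \in X t) && dist_le r (f s) (val s) := xchooseP (inball s).
have f_inj : {in S &, injective f}.
  move=> s s' sS s'S fs; apply/eqP; apply: contraT => ns.
  have /forall_inP/(_ s sS)/forall_inP/(_ s' s'S)/negP[] := stabS.
  rewrite /= /induced_edge /= /power_edge; apply/andP; split=> //.
  have [/andP[_ ds] /andP[_ ds']] := (fP s, fP s').
  apply: (@dist_le_weaken _ (r + r)); first by rewrite /r; lia.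
  by apply: dist_le_trans ds'; rewrite -fs dist_le_sym.
rewrite -(card_in_imset f_inj).
(* Block [i] consists of the old layers from [i * d] to [i * d + d - 1]; the window widens it by [r]
   on both sides. If the subtraction truncates to 0, the window still contains all these layers. *)
apply: leq_trans (card_window (i * d - r) (d + 2 * r) (width t)).
apply: subset_leq_card; apply/subsetP => _ /imsetP[s sS ->].
have /andP[fX ds] := fP s; rewrite inE fX /=.
have := valP s; rewrite in_setI => /andP[_]; rewrite inE /power_layer => /eqP es.
have d1 := dist_le_layer hlay ds; rewrite dist_le_sym in ds.
have d2 := dist_le_layer hlay ds.
have := divn_eq (lay (val s)) d; have := ltn_pmod (lay (val s)) d_gt0.
rewrite es; lia.
Qed.

Lemma power_witness :
  witness_ltin (power G d) T ball_bag power_layer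
    (if odd d then (2 * d - 1) * k else 2 * d * k).
Proof.
split; [exact: ball_bag_decomposition | exact: power_layering |].
move=> t i; apply: leq_trans (alpha_ball_bag t i) _.
(* [2 * (d %/ 2)] equals [d - 1] for odd [d] and [d] for even [d]. *)
by case: ifP => od; rewrite leq_mul2r; apply/orP; right; lia.
Qed.
End PowerDecomposition.

(** * Degree sums and the passage between vertices and their numbers *)

(** Double counting of incidences: sending [y] to [[set x; y]] embeds the neighbours of [x] into the
    edges at [x], and an edge has at most two elements. *)
Lemma sum_degrees (G : sgraph) :
  \sum_(x : G) #|neighbours x| <= 2 * #|edges G|.
Proof.
have deg_le (x : G) : #|neighbours x| <= \sum_(e in edges G) (x \in e).
  have inj : {in neighbours x &, injective (fun y => [set x; y])}.
    move=> y z; rewrite !inE => xy xz eq_xyz.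
    have : y \in [set x; z] by rewrite -eq_xyz set22.
    by rewrite !inE => /orP[/eqP yx|/eqP//]; rewrite yx edge_irr in xy.
  rewrite -(card_in_imset inj) -sum1_card big_mkcond /=.
  rewrite [leqRHS]big_mkcond /=; apply: leq_sum => e _.
  case: ifP => // /imsetP[y]; rewrite inE => xy ->.
  rewrite set21; case: ifP => // /negP[]; rewrite inE.
  by apply/existsP; exists x; apply/existsP; exists y; rewrite xy eqxx.
apply: (@leq_trans (\sum_(x : G) \sum_(e in edges G) (x \in e))).
  by apply: leq_sum => x _; apply: deg_le.
rewrite exchange_big /= mulnC -sum_nat_const; apply: leq_sum => e.
rewrite inE => /existsP[x /existsP[y /andP[_ /eqP->]]].
rewrite -big_mkcond /= sum1_card cards2; by case: (x != y).
Qed.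

Section Encodings.
Variables (G : sgraph) (ls : seq (seq nat)).
Hypothesis lsP : forall x : G,
  perm_eq (nth [::] ls (enum_rank x)) [seq nat_of_ord (enum_rank y) | y in neighbours x].

Lemma mem_ranks (A : {set G}) (y : G) :
  (nat_of_ord (enum_rank y) \in [seq nat_of_ord (enum_rank x) | x in A]) = (y \in A).
Proof.
apply/imageP/idP => [[x xA /val_inj/enum_rank_inj->]//|yA].
by exists y.
Qed.

(** [lsP] describes only the lists at ranks of vertices, so a walk on numbers is lifted from its
    start, each step leading from a rank to a rank. *)
Lemma reach_rank r (A : {set G}) (b : seq nat) (v : nat) :
    b =i [seq nat_of_ord (enum_rank x) | x in A] ->
  reach (nth [::] ls) r b v <->
  exists2 y : G, v = enum_rank y & exists2 x, x \in A & dist_le r x y.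
Proof.
move=> bA; split=> [[v0 [p [v0b szp xp lp]]]|[y -> [x xA /dist_leP[p [szp xp lp]]]]].
  rewrite bA in v0b; have [x xA ev0] := imageP v0b.
  suff [y [q [-> szq xq lq]]] : exists y q, [/\ v = enum_rank y,
      size q = size p, path edge x q & last x q = y].
    by exists y => //; exists x => //; apply/dist_leP; exists q; rewrite szq.
  rewrite {v0b szp xA A bA b}ev0 in xp lp *.
  elim: p x xp lp => [|w p IH] x /=; first by exists x, [::].
  rewrite (perm_mem (lsP x)) => /andP[/imageP[z]]; rewrite inE => xz -> zp lp.
  have [y [q [ev szq zq lq]]] := IH z zp lp.
  by exists y, (z :: q); rewrite /= szq xz.
exists (nat_of_ord (enum_rank x)), [seq nat_of_ord (enum_rank z) | z <- p]; split.
- by rewrite bA mem_ranks.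
- by rewrite size_map.
- elim: p x {xA szp lp} xp => //= z p IH x /andP[xz zp].
  by rewrite (perm_mem (lsP x)) mem_ranks inE xz IH.
- by rewrite (last_map (fun z : G => nat_of_ord (enum_rank z))) lp.
Qed.
End Encodings.

Lemma encoded_lt (A B : finType) (X : A -> {set B}) ls :
    size ls = #|A| ->
    (forall a, perm_eq (nth [::] ls (enum_rank a))
                       [seq nat_of_ord (enum_rank b) | b in X a]) ->
  forall i, all (gtn #|B|) (nth [::] ls i) /\ uniq (nth [::] ls i).
Proof.
move=> szls lsP i; case: (ltnP i #|A|) => [lti|lei]; last first.
  by rewrite nth_default // szls.
have := lsP (enum_val (Ordinal lti)); rewrite enum_valK /= => pe.
rewrite (perm_uniq pe) (perm_all _ pe); split.
  by apply/allP => _ /imageP[b _ ->] /=; apply: ltn_ord.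
by rewrite map_inj_uniq ?enum_uniq // => b c /val_inj/enum_rank_inj.
Qed.

(** * Word size and total cost in terms of the graph *)

(** The dominant term [m * n] is quadratic in the size of the input; since the magnitude is at least
    9, its cube leaves room for the linear terms too. *)
Lemma room (W : nat) (inp : seq nat) (n m q : nat) :
    6 < size inp -> n <= size inp -> m <= size inp ->
    q = size inp + n + 2 + m ->
  q + m * n + n + 8 < magnitude inp ^ 3.
Proof.
move=> szi ni mi ->; set M := magnitude inp.
have leM : 2 + size inp <= M by apply: leq_addr.
have le2 : m * n <= size inp * size inp by apply: leq_mul.
have : 9 * M <= M * M by rewrite leq_mul2r; lia.
have : (size inp).+2 * M <= M * M by rewrite leq_mul2r; lia.
have : 9 * (M * M) <= M * (M * M) by rewrite leq_mul2r; lia.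
rewrite !expnS expn0 muln1; nia.
Qed.

Lemma input_lt (inp : seq nat) i : nth 0 inp i < magnitude inp ^ 3.
Proof.
have : nth 0 inp i < magnitude inp.
  case: (ltnP i (size inp)) => lti; last by rewrite nth_default.
  have := @leq_bigmax_seq _ inp xpredT id _ (mem_nth 0 lti) isT.
  by rewrite /magnitude /=; lia.
move=> /leq_trans; apply; rewrite -{1}[magnitude inp]expn1 leq_pexp2l //.
Qed.

(** Seven units per adjacency entry, and each edge is listed at both of its ends. *)
Lemma cost_degrees (G : sgraph) ls :
    size ls = #|G| ->
    (forall x : G, perm_eq (nth [::] ls (enum_rank x))
       [seq nat_of_ord (enum_rank y) | y in neighbours x]) ->
  cost ls (iota 0 #|G|) <= 7 * 2 * #|edges G| + 10 * #|G|.
Proof.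
move=> szls lsP; rewrite /cost sumnE big_map.
have -> : iota 0 #|G| = index_iota 0 #|G| by rewrite /index_iota subn0.
rewrite big_mkord (reindex (@enum_rank G)) /=; last first.
  by exists enum_val => i _; rewrite ?enum_rankK ?enum_valK.
under eq_bigr => x _ do rewrite (perm_size (lsP x)) size_map -cardE.
rewrite big_split /= -big_distrr /= sum_nat_const.
rewrite [10 * _]mulnC leq_add2r -mulnA leq_mul2l; exact: sum_degrees.
Qed.

(* The bound |T| * (|V(G)| + |E(G)|) is read with |V(G)| + |E(G)| + 1 in place of
   |V(G)| + |E(G)|, which only matters for the null graph, where it would be 0. *)
Theorem theorem3p2 :
  exists (p : cmd) (b c : nat),
  forall (G : sgraph) (d : nat) (T : sgraph) (X : T -> {set G})
         (lay : G -> nat) (k : nat) (inp : seq nat),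
    2 <= d ->
    witness_ltw G T X lay k ->
    encodes_input d G T X lay inp ->
    exists (Td : sgraph) (Xd : Td -> {set power G d})
           (layd : power G d -> nat) (out : seq nat),
      [/\ #|Td| = #|T|,
          witness_ltin (power G d) Td Xd layd
            (if odd d then (2 * d - 1) * k else 2 * d * k),
          encodes_output (power G d) Td Xd layd out
        & computes p b inp out (c * (#|T| * (#|G| + #|edges G| + 1)))].

Proof.
(* The exponent 3 comes from [room]. With [m = #|T|], [n = #|G|] and [e] edges, [power_time] is at
   most [21 * m * n + 14 * m * e + 16 * m + 8 * n + 40]; as a tree has a node, [m >= 1] and 60
   suffices. *)
exists power_cmd, 3, 60 => G d T X lay k inp d2 ltw.
move=> [wG [wT [wX [[lsG [-> szG lsGP]] [lsT [-> szT lsTP]] [lsX [-> szX lsXP]] ->]]]].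
set L := encode_layering lay.
have szL : size L = #|G| by rewrite size_map -cardE.
have adj_lt v := (encoded_lt szG lsGP v).1.
have bag_lt t := (encoded_lt szX lsXP t).1.
have bag_uniq t := (encoded_lt szX lsXP t).2.
rewrite -[_ :: _]/(input d lsG lsT lsX L); set w := input _ _ _ _ _.
rewrite -szG in adj_lt bag_lt szL; rewrite -szT in szX.
have szw := size_input d szX szL; rewrite -/w in szw.
set ls' := new_bags d lsG lsX.
exists T, (@ball_bag G T X d), (@power_layer G lay d), (output d lsG lsT lsX L).
have d0 : 0 < d by apply: ltnW.
split=> //; first exact: power_witness d0 ltw.
  exists (encode_lists lsT), (encode_lists ls'); split.
  - by exists lsT.
  - exists ls'; split=> //; first by rewrite size_map szX szT.
    move=> t; apply: uniq_perm.
    + by case: (new_bag_uniq_lt d szX adj_lt bag_lt (enum_rank t)).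
    + by rewrite map_inj_uniq ?enum_uniq // => b c /val_inj/enum_rank_inj.
    move=> v; rewrite (nth_new_bags d lsG szX); last by rewrite szT ltn_ord.
    set Q := scan _ _.
    have memQ : Q =i [seq nat_of_ord (enum_rank x) | x in X t].
      by move=> u; rewrite mem_scan /= (perm_mem (lsXP t)).
    (* The search starts with [lo = 0], before any expansion, so the invariant asked by [mem_bfs]
       holds vacuously. *)
    apply/idP/imageP => [|[y yt ->]].
      have cl u z : u \in take 0 Q -> z \in nth [::] lsG u -> z \in Q by rewrite take0.
      move=> /(mem_bfs _ _ cl)/(reach_rank lsGP _ _ memQ)[y -> [x xt xy]].
      by exists y => //; apply/ball_bagP; exists x.
    apply/(mem_bfs _ _ _); first by rewrite take0.
    apply/(reach_rank lsGP _ _ memQ); exists y => //.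
    by case/ball_bagP: yt => x xt xy; exists x.
  - by rewrite /output /encode_layering -map_comp.
have T0 : 0 < size lsT by rewrite szT; case: ltw => -[[]].
have [oA oT oX oV oF] := adr_order szX szL.
have [||t [s [ex tle out]]] := @power_run (magnitude w ^ 3) d lsG lsT lsX L szX szL adj_lt bag_lt bag_uniq.
- have szw' := szw; rewrite /adrV /adrL /adrXF /adrX /adrT /adrA in szw'.
  by apply: room => //; lia.
- exact: input_lt.
exists t, s; split=> //; apply: leq_trans tle _.
have := cost_degrees szG lsGP.
rewrite /power_time /bag_time -szG -szT; nia.
Qed.
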